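(* Fix $t\ge2$, put $N=t+2$, and for a partition $\lambda$ with at most $N$ parts let $\Phi_t(\lambda;z)=s_\lambda(1,\zeta,\dots,\zeta^{t-1},z,z^{-1})$, $\zeta=e^{2\pi i/t}$. Let $\lambda,\mu$ be partitions with at most $N$ parts and suppose $\Phi_t(\lambda;z)\not\equiv0$. Then $\Phi_t(\lambda;z)=\Phi_t(\mu;z)$ (as Laurent polynomials in $z$) if and only if the triple and sign of $\mu$ are defined, $\{d_1,d_2,d_3\}(\lambda)=\{d_1,d_2,d_3\}(\mu)$ as multisets, and $\varepsilon_\lambda=\varepsilon_\mu$.
   Context: For $\lambda=(\lambda_1\ge\dots\ge\lambda_N\ge0)$ let $\beta_j=\lambda_j+N-j$ ($1\le j\le N$; $j$ is the column of $\beta_j$), $\beta(\lambda)=\{\beta_1>\dots>\beta_N\}$, and let $n_i$ be the number of $\beta_j\equiv i\pmod t$. Since $\sum_i n_i=t+2$, if no class is empty then either exactly two classes have size $2$ (others $1$) or exactly one has size $3$ (others $1$). In the first case let $r_A<r_B$ be the two residues and $A=\{a_1>a_2\}$, $B=\{b_1>b_2\}$ the elements of $\beta(\lambda)$ in classes $r_A,r_B$; in the second case, with class $\{p>q>r\}$, let $A=\{a_1>a_2\}=\{p,q\}$, $B=\{b_1>b_2\}=\{q,r\}$. Put $d_1=a_1-a_2$, $d_2=b_1-b_2$, $\tilde d_3=a_1+a_2-b_1-b_2$, $d_3=|\tilde d_3|$. When no class is empty and $\tilde d_3\ne0$ (which is equivalent to $\Phi_t(\lambda;z)\not\equiv 0$),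 the sign is $\varepsilon_\lambda=(-1)^{t+\binom{N+1}{2}}(-1)^{j_{A_1}+j_{B_1}+\operatorname{inv}(b_S)}\operatorname{sgn}(a_1-b_1)\operatorname{sgn}(\tilde d_3)$, where $j_{A_1},j_{B_1}$ are the columns of $a_1,b_1$, $S=\{1,\dots,N\}\setminus\{j_{A_1},j_{B_1}\}$, $b_S$ is the word of residues $\beta_j\bmod t\in\{0,\dots,t-1\}$ for $j\in S$ in increasing order of $j$, and $\operatorname{inv}$ counts inversions. The triple and sign are called defined when no class is empty and $\tilde d_3\neq0$. *)

(* Defs.v *)
From mathcomp Require Import all_boot all_order all_algebra.
From mathcomp Require Import reals trigo.
From mathcomp Require Import perm complex.
From mathcomp Require Import ring lra zify.

Set Implicit Arguments.
Unset Strict Implicit.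
Unset Printing Implicit Defensive.

Import Order.TTheory GRing.Theory Num.Theory.

Local Open Scope ring_scope.
Local Open Scope complex_scope.

Section BetaSet.

(* A partition with at most N parts is a weakly decreasing N-tuple of naturals,
   padded with zeros.  Columns are numbered from 1 to N. *)
Definition is_partition (N : nat) (lam : N.-tuple nat) : bool := sorted geq lam.

Definition beta (N : nat) (lam : N.-tuple nat) (j : nat) : nat :=
  (nth 0 lam j.-1 + (N - j))%N.

(* For a partition this list is strictly decreasing. *)
Definition betas (N : nat) (lam : N.-tuple nat) : seq nat :=
  [seq beta lam j | j <- iota 1 N].

Definition column (N : nat) (lam : N.-tuple nat) (b : nat) : nat :=
  (index b (betas lam)).+1.

End BetaSet.

Section Schur.

Definition alternant (F : fieldType) (N : nat) (e : nat -> nat)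
    (x : 'I_N -> F) : F :=
  \det (\matrix_(i < N, j < N) x i ^+ e j.+1).

(* The bialternant formula; this is the value of the Schur polynomial at x when
   the coordinates of x are pairwise distinct.  This holds for the point used in
   [Phi]: see [point_inj] and [point_alternant_neq0]. *)
Definition schur (F : fieldType) (N : nat) (lam : N.-tuple nat)
    (x : 'I_N -> F) : F :=
  alternant (beta lam) x / alternant (fun j => (N - j)%N) x.

Definition zeta (R : realType) (t : nat) : R[i] :=
  cos (2 * pi / t%:R) +i* sin (2 * pi / t%:R).

(* Laurent polynomials in z over the complex numbers are regarded inside the
   field of rational functions in z. *)
Definition zvar (R : realType) : {fraction {poly R[i]}} := tofrac 'X.

Definition point (R : realType) (t : nat) (k : 'I_t.+2) :
    {fraction {poly R[i]}} :=
  if (k < t)%N then tofrac (zeta R t ^+ k)%:P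
  else if k == t :> nat then zvar R
  else (zvar R)^-1.

Definition Phi (R : realType) (t : nat) (lam : t.+2.-tuple nat) :
    {fraction {poly R[i]}} :=
  schur lam (@point R t).

End Schur.

Section TripleAndSign.

Variables (t : nat) (lam : t.+2.-tuple nat).

Definition residue_class (i : nat) : seq nat :=
  [seq b <- betas lam | b %% t == i]%N.

Definition no_empty_class : bool :=
  all (fun i => residue_class i != [::]) (iota 0 t).

(* (a1, a2, b1, b2).  Classes are listed by increasing residue, and each class
   in decreasing order.  The default value is reached only when some class is
   empty. *)
Definition pairsAB : nat * nat * nat * nat :=
  match [seq residue_class i | i <- iota 0 t & (1 < size (residue_class i))%N]
  with
  | [:: [:: a1; a2]; [:: b1; b2]] => (a1, a2, b1, b2)
  | [:: [:: p; q; r]] => (p, q, q, r)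
  | _ => (0, 0, 0, 0)%N
  end.

Definition a1 : nat := pairsAB.1.1.1.
Definition a2 : nat := pairsAB.1.1.2.
Definition b1 : nat := pairsAB.1.2.
Definition b2 : nat := pairsAB.2.

Definition d1 : nat := (a1 - a2)%N.
Definition d2 : nat := (b1 - b2)%N.
Definition dt3 : int := a1%:Z + a2%:Z - b1%:Z - b2%:Z.
Definition d3 : nat := `|dt3|%N.

Definition triple : seq nat := [:: d1; d2; d3].

Definition triple_defined : bool := no_empty_class && (dt3 != 0).

Definition inversions (w : seq nat) : nat :=
  (\sum_(l < size w) \sum_(k < l) (nth 0 w l < nth 0 w k))%N.

Definition columnsS : seq nat :=
  [seq j <- iota 1 t.+2 | j \notin [:: column lam a1; column lam b1]].

Definition bS : seq nat := [seq (beta lam j %% t)%N | j <- columnsS].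

(* Meaningful only under [triple_defined]. *)
Definition epsilon : int :=
  (-1) ^+ (t + 'C(t.+3, 2))%N *
  (-1) ^+ (column lam a1 + column lam b1 + inversions bS)%N *
  sgz (a1%:Z - b1%:Z) * sgz dt3.

End TripleAndSign.

Section DenominatorNonzero.

Variables (R : realType) (t : nat).
Hypothesis t_gt1 : (1 < t)%N.

Lemma zetaX k : zeta R t ^+ k =
  cos (k%:R * (2 * pi / t%:R)) +i* sin (k%:R * (2 * pi / t%:R)).
Proof.
elim: k => [|k IHk]; first by rewrite expr0 mul0r cos0 sin0.
rewrite exprSr IHk /zeta -(natr1 k) (mulrDl k%:R) mul1r cosD sinD.
by apply/eqP; rewrite eq_complex /= eqxx addrC eqxx.
Qed.

Lemma zeta_prim : t.-primitive_root (zeta R t).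
Proof.
have t_gt0 : (0 < t)%N := ltnW t_gt1.
have t_neq0 : t%:R != 0 :> R by rewrite pnatr_eq0 -lt0n.
apply/andP; split => //.
apply/forallP => i; rewrite unity_rootE zetaX; apply/eqP.
have [->|neq_it] := eqVneq i.+1 t.
  by rewrite mulrC divfK // mulr_natl cos2pi sin2pi; apply/eqP.
have lt_it : (i.+1 < t)%N by rewrite ltn_neqAle neq_it ltn_ord.
set x : R := i.+1%:R * (pi / t%:R).
have -> : i.+1%:R * (2 * pi / t%:R) = x *+ 2.
  by rewrite /x; ring.
have sx_gt0 : 0 < sin x.
  apply: sin_gt0_pi; apply/andP; split; rewrite /x.
    by rewrite mulr_gt0 ?ltr0n // divr_gt0 ?pi_gt0 // ltr0n.
  by rewrite mulrCA gtr_pMr ?pi_gt0 // ltr_pdivrMr ?ltr0n // mul1r ltr_nat.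
apply: negbTE; rewrite eq_complex /= cos_mulr2n cos2sin2.
rewrite negb_and lt_eqF //.
have := exprn_gt0 2 sx_gt0; lra.
Qed.

Lemma zvar_neq_const (c : R[i]) : (zvar R == tofrac c%:P) = false.
Proof.
rewrite tofrac_eq; apply/negP => /eqP /(congr1 (fun p : {poly R[i]} => p`_1)).
by rewrite coefX coefC; apply/eqP/oner_neq0.
Qed.

Lemma zvarV_neq_const (c : R[i]) : ((zvar R)^-1 == tofrac c%:P) = false.
Proof.
rewrite -(invrK (tofrac _)) (inj_eq invr_inj).
have [->|c0] := eqVneq c 0.
  by rewrite tofrac0 invr0 tofrac_eq0 polyX_eq0.
suff -> : (tofrac c%:P)^-1 = tofrac (c^-1)%:P by exact: zvar_neq_const.
apply: (mulfI (x := tofrac c%:P)); first by rewrite tofrac_eq0 polyC_eq0.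
by rewrite -tofracM -polyCM !mulfV ?tofrac1 // tofrac_eq0 polyC_eq0.
Qed.

Lemma zvar_neqV : (zvar R == (zvar R)^-1) = false.
Proof.
have z0 : zvar R != 0 by rewrite tofrac_eq0 polyX_eq0.
apply/negP => /eqP /(congr1 ( *%R (zvar R))); rewrite mulfV // -tofracM.
move/eqP; rewrite -tofrac1 tofrac_eq => /eqP.
move/(congr1 (fun p : {poly R[i]} => p`_2)); rewrite -expr2 coefXn coef1 /=.
by apply/eqP/oner_neq0.
Qed.

Lemma point_inj : injective (@point R t).
Proof.
move=> i j; have := ltn_ord i; have := ltn_ord j.
rewrite /point => lj li /eqP; apply: contraTeq => /negbTE; rewrite -val_eqE /= => nij.
have inv_eq : ((zvar R)^-1 == zvar R) = false by rewrite eq_sym zvar_neqV.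
case: ltngtP (nij) => ci; case: ltngtP => cj nij' //;
  rewrite ?zvar_neq_const ?zvarV_neq_const ?zvar_neqV ?inv_eq //
    1?eq_sym ?zvar_neq_const ?zvarV_neq_const ?zvar_neqV ?inv_eq //.
- by rewrite tofrac_eq (inj_eq polyC_inj) (eq_prim_root_expr zeta_prim) !modn_small // eq_sym nij'.
- by exfalso; lia.
- by exfalso; lia.
Qed.

Lemma point_alternant_neq0 : alternant (fun j => t.+2 - j)%N (@point R t) != 0.
Proof.
pose V := Vandermonde t.+2 (\row_j @point R t j).
suff defM : (\matrix_(i < t.+2, j < t.+2) (point R i) ^+ (t.+2 - j.+1)) =
    col_perm (perm (@rev_ord_inj t.+2)) V^T.
  rewrite /alternant defM col_permE det_mulmx det_tr det_Vandermonde det_perm.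
  rewrite mulf_neq0 ?signr_eq0 //; apply/prodf_neq0 => i _.
  apply/prodf_neq0 => j ij; rewrite !mxE subr_eq0 (inj_eq point_inj).
  by rewrite -val_eqE /= gtn_eqF.
by apply/matrixP => i j; rewrite !mxE permE.
Qed.

End DenominatorNonzero.

(* Main.v *)
(* If a residue class is empty, the first t rows of the alternant of lambda are
   dependent.  Otherwise the columns other than those of a_1 and b_1 carry each
   residue once: sorting them by residue and moving a_1, b_1 to the end costs the
   sign in epsilon, and subtracting from the last two columns those of the same
   residue leaves the Fourier determinant times a 2 x 2 determinant equal to
   - [a_1 - a_2] [b_1 - b_2] [a_1 + a_2 - b_1 - b_2], with [n] = z^(n/2) - z^(-n/2).
   So Phi is a nonzero constant independent of lambda times epsilon [d_1] [d_2] [d_3],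
   and such a product determines epsilon and the multiset of the d_i. *)

Require Import Defs.
From mathcomp Require Import all_boot all_order all_algebra.
From mathcomp Require Import reals.
From mathcomp Require Import trigo perm complex ring lra zify.

Import Order.TTheory GRing.Theory Num.Theory.

Local Open Scope ring_scope.

Set Implicit Arguments.
Unset Strict Implicit.
Unset Printing Implicit Defensive.

(** * Signs of permutations and inversions of words *)

Lemma sgz_prod (I : Type) (r : seq I) (P : pred I) (F : I -> int) :
  sgz (\prod_(i <- r | P i) F i) = \prod_(i <- r | P i) sgz (F i).
Proof.
apply: (big_morph (fun x : int => sgz x)) => [x y|]; first exact: sgzM.
exact: sgz1.
Qed.

(* Signs of the two sides of det V(s 0, .., s (n - 1)) = (-1)^s det V(0, .., n - 1). *)
Lemma sign_inversions (n : nat) (s : 'S_n) :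
  (-1) ^+ s = (-1) ^+ (\sum_(j < n) \sum_(i < n | (i < j)%N) (s j < s i)%N)%N
    :> int.
Proof.
have sgB (i j : nat) : (i != j)%N -> sgz (j%:Z - i%:Z) = (-1) ^+ (j < i)%N.
  move=> nij; case: (ltnP j i) => cij.
    by rewrite ltr0_sgz ?expr1 // subr_lt0 ltz_nat.
  by rewrite gtr0_sgz ?expr0 // subr_gt0 ltz_nat ltn_neqAle nij.
have VP : \det (Vandermonde n (\row_j (s j)%:Z)) =
    (-1) ^+ s * \det (Vandermonde n (\row_(j < n) j%:Z)).
  have -> : Vandermonde n (\row_j (s j)%:Z) =
      col_perm s (Vandermonde n (\row_(j < n) j%:Z)).
    by apply/matrixP => i j; rewrite !mxE.
  by rewrite col_permE det_mulmx det_perm odd_permV mulrC.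
have {VP} := congr1 (fun x : int => sgz x) VP.
rewrite /= sgzM !det_Vandermonde !sgz_prod.
(* The increasing points 0, ..., n - 1 give only positive factors, so this determinant has sign
   1. *)
rewrite [X in _ = _ * X -> _]big1 ?mulr1 => [|i _]; last first.
  rewrite sgz_prod big1 // => j ij.
  by rewrite !mxE sgB ?ltn_eqF // ltnNge (ltnW ij).
have -> : sgz ((-1) ^+ s : int) = (-1) ^+ s by case: (odd_perm s).
move=> <-; under eq_bigr => i _ do rewrite sgz_prod.
rewrite (exchange_big_dep xpredT) //= -prodrXr; apply: eq_bigr => j _.
rewrite -prodrXr; apply: eq_bigr => i ij.
by rewrite !mxE sgB // (inj_eq val_inj) (inj_eq perm_inj) -val_eqE /= ltn_eqF.
Qed.

Lemma inversions_rcons (w : seq nat) (x : nat) :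
  inversions (rcons w x) = (inversions w + count (ltn x) w)%N.
Proof.
rewrite /inversions size_rcons big_ord_recr /=; congr (_ + _)%N.
  apply: eq_bigr => l _; apply: eq_bigr => k _.
  by rewrite !nth_rcons ltn_ord (ltn_trans (ltn_ord k)).
rewrite nth_rcons ltnn eqxx -sumn_count sumnE big_map (big_nth 0%N) big_mkord.
by apply: eq_bigr => k _; rewrite nth_rcons ltn_ord.
Qed.

(** Indexing by pairs of original positions, rather than positions in the filtered word, lets the
    inversions of [bS] be matched term by term with those of a permutation of all columns. *)
Lemma inversions_filter (f : nat -> nat) (P : pred nat) (m n : nat) :
  inversions [seq f j | j <- iota m n & P j] =
  (\sum_(l < n) \sum_(k < n | (k < l)%N)
     [&& P (m + l), P (m + k) & f (m + l) < f (m + k)])%N.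
Proof.
elim: n => [|n IHn]; first by rewrite /inversions /= !big_ord0.
rewrite -addn1 iotaD addn1 /= cats1 filter_rcons big_ord_recr /=.
rewrite [X in _ = (_ + X)%N]big_mkcond.
rewrite big_ord_recr /= ltnn addn0.
have -> : (\sum_(l < n) \sum_(k < n.+1 | (k < l)%N)
     [&& P (m + l), P (m + k) & f (m + l) < f (m + k)] =
    inversions [seq f j | j <- iota m n & P j])%N.
  rewrite IHn; apply: eq_bigr => l _.
  rewrite big_mkcond big_ord_recr /= ltnNge (ltnW (ltn_ord l)) addn0.
  by rewrite -big_mkcond.
under eq_bigr => k _ do rewrite ltn_ord.
case: (P (m + n)%N) => /=; last by rewrite big1 ?addn0.
rewrite map_rcons inversions_rcons count_map; congr (_ + _)%N.
rewrite count_filter -sumn_count sumnE big_map -[m in iota m n]addn0.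
rewrite iotaDl big_map -[n in iota 0 n]subn0 big_mkord.
by apply: eq_bigr => k _; rewrite /= andbC.
Qed.

(** * Recovering exponents from a product of factors X^d - 1 *)

Lemma prim_root_complex (R : realType) (d : nat) :
  (0 < d)%N -> {w : R[i] | d.-primitive_root w}.
Proof.
case: d => // -[|d] _; last by exists (zeta R d.+2); apply: zeta_prim.
exists 1; apply/andP; split=> //.
by apply/forallP => i; rewrite ord1 unity_rootE expr1 !eqxx.
Qed.

Lemma seq_max (s : seq nat) :
  s != [::] -> exists2 d, d \in s & {in s, forall e, (e <= d)%N}.
Proof.
elim: s => // x s IHs _; have [->|/IHs[d ds dmax]] := eqVneq s [::].
  by exists x => [|e]; rewrite inE ?eqxx // => /eqP ->.
case: (leqP x d) => [xd|dx].
  by exists d => [|e]; rewrite inE ?ds ?orbT // => /predU1P[->|/dmax].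
exists x => [|e]; rewrite inE ?eqxx // => /predU1P[->|/dmax ed] //.
exact: leq_trans ed (ltnW dx).
Qed.

(* If d is the largest of the exponents, then a primitive d-th root of unity is a
   root of a product exactly when d is one of its exponents. *)
Lemma perm_eq_prod_Xn_sub1 (R : realType) (s1 s2 : seq nat) :
    all (ltn 0) s1 -> all (ltn 0) s2 ->
  \prod_(d <- s1) ('X^d - 1) = \prod_(d <- s2) ('X^d - 1) :> {poly R[i]} ->
  perm_eq s1 s2.
Proof.
have [n] := ubnP (size s1); elim: n s1 s2 => // n IHn s1 s2 ltn_n s1_gt0 s2_gt0.
have [|s12N] := eqVneq (s1 ++ s2) [::].
  by case: s1 s2 {ltn_n s1_gt0 s2_gt0} => [|? ?] [|? ?].
have [d ds dmax] := seq_max s12N.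
have d_gt0 : (0 < d)%N.
  by move: ds; rewrite mem_cat => /orP[]; [exact: allP s1_gt0 d | exact: allP s2_gt0 d].
have [w wP] := prim_root_complex R d_gt0.
have root_prod (s : seq nat) : {subset s <= s1 ++ s2} -> all (ltn 0) s ->
    root (\prod_(e <- s) ('X^e - 1)) w = (d \in s).
  move=> ss s_gt0; rewrite rootE horner_prod prodf_seq_eq0 /= -has_pred1.
  apply: eq_in_has => e es; rewrite !hornerE subr_eq0 -(prim_order_dvd wP) /=.
  apply/idP/eqP => [de|->] //; apply/eqP; rewrite eqn_leq dmax ?ss //.
  exact: dvdn_leq (allP s_gt0 e es) de.
move=> eq12; have ds12 : (d \in s1) = (d \in s2).
  by rewrite -!root_prod ?eq12 // => e es; rewrite mem_cat es ?orbT.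
have ds2 : d \in s2 by move: ds; rewrite mem_cat ds12 orbb.
have p2 := perm_to_rem ds2; rewrite -ds12 in ds2; have p1 := perm_to_rem ds2.
rewrite (permPl p1) perm_sym (permPl p2) perm_cons perm_sym.
apply: IHn.
- by move: ltn_n; rewrite (perm_size p1).
- by move: s1_gt0; rewrite (perm_all _ p1) => /andP[].
- by move: s2_gt0; rewrite (perm_all _ p2) => /andP[].
move: eq12; rewrite (perm_big _ p1) (perm_big _ p2) !big_cons; apply: mulfI.
by rewrite -size_poly_eq0 size_XnsubC.
Qed.

(** * Beta numbers and their residue classes *)

Lemma nth_betas N (lam : N.-tuple nat) j : (j < N)%N ->
  nth 0%N (betas lam) j = beta lam j.+1.
Proof. by move=> jN; rewrite (nth_map 0%N) ?size_iota // nth_iota // add1n. Qed.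

Lemma size_betas N (lam : N.-tuple nat) : size (betas lam) = N.
Proof. by rewrite size_map size_iota. Qed.

Lemma sorted_betas N (lam : N.-tuple nat) :
  is_partition lam -> sorted gtn (betas lam).
Proof.
move=> lamP; apply/(sortedP 0%N) => i; rewrite size_betas => iN.
rewrite !nth_betas ?(ltnW iN) // /beta /=.
have := sortedP 0%N lamP; rewrite size_tuple => /(_ i iN) /=; lia.
Qed.

Lemma uniq_betas N (lam : N.-tuple nat) : is_partition lam -> uniq (betas lam).
Proof. by move=> /sorted_betas; rewrite gtn_sorted_uniq_geq => /andP[]. Qed.

Lemma column_le N (lam : N.-tuple nat) b :
  b \in betas lam -> (column lam b <= N)%N.
Proof. by rewrite -index_mem size_betas. Qed.

Lemma beta_column N (lam : N.-tuple nat) b :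
  b \in betas lam -> beta lam (column lam b) = b.
Proof.
move=> bl; have := nth_betas lam (_ : (index b (betas lam) < N)%N).
rewrite nth_index // => <- //.
by rewrite -[ltnRHS](size_betas lam) index_mem.
Qed.

Lemma beta_lt N (lam : N.-tuple nat) i j : is_partition lam ->
  (0 < i)%N -> (i < j)%N -> (j <= N)%N -> (beta lam j < beta lam i)%N.
Proof.
case: i j => [|i] [|j] // /sorted_betas lamP _ ij jN.
have iN : (i < N)%N by rewrite (ltn_trans _ jN).
rewrite -(nth_betas lam jN) -(nth_betas lam iN).
apply: (sorted_ltn_nth (leT := gtn)) => //.
- by move=> x y z /= xy yz; apply: ltn_trans xy.
- by rewrite inE size_betas (ltn_trans _ jN).
- by rewrite inE size_betas.
Qed.

(** Double counting: each beta number lies in the class of exactly one residue below [t]. *)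
Lemma sum_size_residue_class (t : nat) (lam : t.+2.-tuple nat) : (0 < t)%N ->
  (\sum_(i <- iota 0 t) size (residue_class lam i))%N = t.+2.
Proof.
move=> t_gt0; under eq_bigr => i _ do
  rewrite size_filter -sumn_count sumnE big_map.
rewrite exchange_big /= -[RHS](size_betas lam) -sum1_size; apply: eq_bigr => b _.
have /= := count_uniq_mem (b %% t)%N (iota_uniq 0 t).
rewrite mem_iota leq0n ltn_pmod //= => <-; rewrite -sumn_count sumnE big_map.
by apply: eq_bigr => i _; rewrite eq_sym.
Qed.

(* The pairs chosen by pairsAB, with the elements uA, uB of the classes of a1 and
   b1 that survive the removal of a1 and b1; these coincide for a class of size 3. *)
Lemma pairsABP (t : nat) (lam : t.+2.-tuple nat) :
  (0 < t)%N -> is_partition lam -> no_empty_class lam ->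
  [/\ a1 lam \in betas lam, b1 lam \in betas lam, a1 lam != b1 lam,
      (a2 lam < a1 lam)%N /\ (b2 lam < b1 lam)%N &
      exists uA uB : nat,
      [/\ uA \in [seq b <- betas lam | b \notin [:: a1 lam; b1 lam]],
          uB \in [seq b <- betas lam | b \notin [:: a1 lam; b1 lam]],
          uA = a1 lam %[mod t], uB = b1 lam %[mod t] &
          (uA, uB) = (a2 lam, b2 lam) \/
          a2 lam = b1 lam /\ (uA, uB) = (b2 lam, b2 lam)]].
Proof.
move=> t_gt0 lamP ne.
pose big := [seq i <- iota 0 t | (1 < size (residue_class lam i))%N].
have big_uniq : uniq big by rewrite filter_uniq ?iota_uniq.
(* The t nonempty classes share t + 2 elements, so the excesses of their sizes over 1 add up to
   2. *)
have excess : (\sum_(i <- big) (size (residue_class lam i)).-1 = 2)%N.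
  have := sum_size_residue_class lam t_gt0.
  rewrite (eq_big_seq (fun i => (size (residue_class lam i)).-1 + 1)%N); last first.
    by move=> i /(allP ne); case: residue_class => //= x s _; rewrite addn1.
  rewrite big_split /= sum1_size size_iota -addn2 addnC => /addnI <-.
  rewrite big_filter big_mkcond; apply: eq_bigr => i _.
  by case: residue_class => [|? []].
have big_gt1 i : i \in big -> (1 < size (residue_class lam i))%N.
  by rewrite mem_filter => /andP[].
have class_sorted i : sorted gtn (residue_class lam i).
  apply: sorted_filter (sorted_betas lamP) => x y z /= xy yz.
  exact: ltn_trans yz xy.
have class_mem i x :
    (x \in residue_class lam i) = (x %% t == i)%N && (x \in betas lam).
  by rewrite mem_filter.
rewrite /a1 /a2 /b1 /b2 /pairsAB -/big.
move: (betas lam) class_mem => bl class_mem.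
(* By the excess, one large class has size 3, two have size 2 each, and zero or at least three large
   classes are impossible. *)
case: big big_uniq excess big_gt1 => [|i [|j [|k s]]] /=.
- by rewrite big_nil.
- rewrite big_seq1 => _.
  have := class_sorted i; have := class_mem i.
  case: residue_class => [|p [|q [|r []]]] //= memi /andP[qp /andP[rq _]] _ _.
  have := memi p; have := memi q; have := memi r.
  rewrite !inE !eqxx ?orbT => /esym/andP[/eqP ri rl] /esym/andP[/eqP qi ql].
  move=> /esym/andP[/eqP pi pl]; split=> //; first by rewrite gtn_eqF.
  exists r, r; split; rewrite ?pi ?qi ?ri //; last by right.
    by rewrite mem_filter rl !inE; lia.
  by rewrite mem_filter rl !inE; lia.
- rewrite !big_cons big_nil inE andbT => nij exc gt1.
  have /gt1 szi : i \in [:: i; j] by rewrite inE eqxx.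
  have /gt1 szj : j \in [:: i; j] by rewrite !inE eqxx orbT.
  have [{}szi {}szj] : size (residue_class lam i) = 2 /\
                      size (residue_class lam j) = 2.
    by move: exc szi szj; clear; lia.
  have := class_sorted i; have := class_sorted j.
  have := class_mem i; have := class_mem j; move: szi szj.
  case: (residue_class lam i) => [|p [|q []]] //= _.
  case: (residue_class lam j) => [|r [|s []]] //= _.
  move=> memj memi; rewrite !andbT => sr qp.
  have := memi p; have := memi q; have := memj r; have := memj s.
  rewrite !inE !eqxx ?orbT => /esym/andP[/eqP sj sl] /esym/andP[/eqP rj rl].
  move=> /esym/andP[/eqP qi ql] /esym/andP[/eqP pi pl].
  have npr : p != r by apply: contraNneq nij => pr; rewrite -pi -rj pr.
  have nqr : q != r by apply: contraNneq nij => pr; rewrite -qi -rj pr.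
  have nps : p != s by apply: contraNneq nij => pr; rewrite -pi -sj pr.
  split=> //; exists q, s; split; rewrite ?pi ?qi ?rj ?sj //; last by left.
    by rewrite mem_filter ql !inE; lia.
  by rewrite mem_filter sl !inE; lia.
- rewrite !big_cons => _ exc gt1.
  have /gt1 szi : i \in [:: i, j, k & s] by rewrite inE eqxx.
  have /gt1 szj : j \in [:: i, j, k & s] by rewrite !inE eqxx orbT.
  have /gt1 szk : k \in [:: i, j, k & s] by rewrite !inE eqxx !orbT.
  by move: exc szi szj szk; clear; lia.
Qed.

(** * Determinant identities *)

(** The upper right block repeats columns of [A]; subtracting the corresponding full columns clears
    it and leaves a block triangular matrix. *)
Lemma det_block_colsub (K : comNzRingType) (m n : nat) (f : 'I_m -> 'I_n)
    (A : 'M[K]_n) (G : 'M[K]_(m, n)) (H : 'M[K]_m) :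
  \det (block_mx A (colsub f A) G H) = \det A * \det (H - colsub f G).
Proof.
have -> : block_mx A (colsub f A) G H =
    block_mx A 0 G (H - colsub f G) *m block_mx 1%:M (colsub f 1%:M) 0 1%:M.
  rewrite mulmx_block !mulmx1 !mulmx0 ?mul0mx !mulmx_colsub !mulmx1 ?mul0mx !addr0.
  by rewrite addrC subrK.
by rewrite det_mulmx det_lblock det_ublock !det1 !mulr1.
Qed.

Lemma det_mx22 (K : comNzRingType) (A : 'M[K]_2) :
  \det A = A 0 0 * A 1 1 - A 0 1 * A 1 0.
Proof.
rewrite (expand_det_row _ 0) !big_ord_recl big_ord0 /cofactor !det_mx11 !mxE /=.
rewrite addr0 expr0 expr1 mul1r mulN1r mulrN.
by congr (_ * A _ _ - A _ _ * A _ _); apply/val_inj.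
Qed.

(** Block decompositions live in size [t + 2], whereas the alternant has size [t.+2]. *)
Lemma det_cast (K : comNzRingType) (m n : nat) (h : m = n) (A : 'M[K]_n) :
  \det A = \det (\matrix_(i < m, j < m) A (cast_ord h i) (cast_ord h j)).
Proof.
case: n / h A => A; congr (\det _); apply/matrixP => i j.
by rewrite mxE !cast_ord_id.
Qed.

(** * Evaluation of the alternant *)

Section Numerator.

Variables (R : realType) (t : nat).
Hypothesis t_gt1 : (1 < t)%N.

Let K := {fraction {poly R[i]}}.
Let cst (c : R[i]) : K := tofrac c%:P.

Definition fourier : 'M[K]_t :=
  \matrix_(i < t, k < t) tofrac (zeta R t ^+ (i * k))%:P.

Lemma det_fourier_neq0 : \det fourier != 0.
Proof.
have -> : fourier = Vandermonde t (\row_k tofrac (zeta R t ^+ k)%:P).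
  by apply/matrixP => i k; rewrite !mxE -tofracXn -polyC_exp -exprM mulnC.
rewrite det_Vandermonde; apply/prodf_neq0 => i _; apply/prodf_neq0 => j ij.
rewrite !mxE subr_eq0 tofrac_eq (inj_eq polyC_inj).
by rewrite (eq_prim_root_expr (zeta_prim R t_gt1)) !modn_small // gtn_eqF.
Qed.

Lemma point_root (i : 'I_t.+2) (e : nat) : (i < t)%N ->
  point R i ^+ e = tofrac (zeta R t ^+ (i * (e %% t)))%:P.
Proof.
move=> it; rewrite /point it -tofracXn -polyC_exp -exprM.
by rewrite mulnC exprM -(prim_expr_mod (zeta_prim R t_gt1) e) -exprM mulnC.
Qed.

(* The row vector (zeta^(- i k))_k, for an empty class i, annihilates every column. *)
Lemma alternant_empty_class (lam : t.+2.-tuple nat) :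
  ~~ no_empty_class lam -> alternant (beta lam) (@point R t) = 0.
Proof.
case/allPn => r; rewrite mem_iota add0n => /andP[_ rt]; rewrite negbK => /eqP r0.
apply/eqP/det0P.
(* The exponent [t - r] stands for -r, and the two zero entries discard the rows of z and its
   inverse. *)
exists (\row_(k < t.+2) if (k < t)%N then tofrac (zeta R t ^+ (k * (t - r)))%:P
                        else 0).
  apply/eqP => /matrixP /(_ 0 ord0) /eqP; rewrite !mxE (ltnW t_gt1).
  by rewrite mul0n expr0 tofrac1 oner_eq0.
apply/matrixP => i j; rewrite !mxE !big_ord_recr /= !mxE /= ltnn ltnNge leqnSn.
rewrite !mul0r !addr0.
(* Column j yields the sum of the first t powers of [w]. It vanishes because w^t = 1 while [w = 1]
   would put the beta number of this column in the empty class. *)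
pose w := zeta R t ^+ (t - r + beta lam j.+1).
have w_neq1 : w != 1.
  rewrite -(prim_order_dvd (zeta_prim R t_gt1)).
  apply: contraFN (in_nil (beta lam j.+1)).
  move=> dv; rewrite -r0 mem_filter map_f ?mem_iota ?andbT; last first.
    by rewrite /= add1n ltnS.
  rewrite -[X in _ == X](modn_small rt) -(eqn_modDr (t - r)) subnKC ?(ltnW rt) //.
  by rewrite modnn addnC; exact: dv.
have sum0 : \sum_(k < t) w ^+ k = 0.
  apply: (mulfI (x := w - 1)); first by rewrite subr_eq0.
  rewrite -subrX1 mulr0 /w -exprM mulnC exprM.
  by rewrite (prim_expr_order (zeta_prim R t_gt1)) expr1n subrr.
transitivity (\sum_(k < t) cst (w ^+ k)); last first.
  by rewrite /cst -!rmorph_sum sum0.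
apply: eq_bigr => k _; rewrite !mxE /= ltn_ord /point /= ltn_ord.
rewrite -!tofracXn -!tofracM -!polyC_exp -!polyCM -!exprM -exprD.
by rewrite -mulnDr (mulnC k).
Qed.

End Numerator.

(** The 2 x 2 determinant in the rows of z and its inverse, once the columns of exponents [p'] and
    [q'] are subtracted from those of [p] and [q]. *)
Definition cross (K : fieldType) (z : K) (p p' q q' : nat) : K :=
  (z ^+ p - z ^+ p') * (z ^- q - z ^- q') -
  (z ^+ q - z ^+ q') * (z ^- p - z ^- p').

(** Moving each column j to place [s j] makes the upper left block the Fourier matrix. In the upper
    rows the last two columns then repeat those of [kA] and [kB], which may coincide, so
    [det_block_colsub] applies. *)
Lemma alternant_split (R : realType) (t : nat) (t_gt1 : (1 < t)%N)
    (e : nat -> nat) (s : 'S_t.+2) (jA jB kA kB : 'I_t.+2) :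
  s jA = t :> nat -> s jB = t.+1 :> nat ->
  (forall j, (s j < t)%N -> (s j = e j.+1 %% t :> nat)%N) ->
  (s kA = e jA.+1 %% t :> nat)%N -> (s kB = e jB.+1 %% t :> nat)%N ->
  alternant e (@point R t) =
  (-1) ^+ s * \det (fourier R t) *
  cross (zvar R) (e jA.+1) (e kA.+1) (e jB.+1) (e kB.+1).
Proof.
move=> sA sB sS skA skB; have t_gt0 := ltnW t_gt1.
rewrite /alternant; set M := matrix_of_fun _ _.
have -> : \det M = (-1) ^+ s * \det (col_perm s^-1 M).
  by rewrite col_permE invgK det_mulmx det_perm mulrCA -expr2 sqrr_sign mulr1.
rewrite -mulrA; congr (_ * _); rewrite (det_cast (addn2 t)).
set M' := matrix_of_fun _ _.
have rA : (s kA < t)%N by rewrite skA ltn_pmod.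
have rB : (s kB < t)%N by rewrite skB ltn_pmod.
(* The places, among the first t, of the columns sharing the residues of [jA] and [jB]. *)
pose f (c : 'I_2) := if c == 0 then Ordinal rA else Ordinal rB.
have ME (i : 'I_(t + 2)) (j : 'I_t.+2) (k : 'I_(t + 2)) : k = s j :> nat ->
    M' i k = point R (cast_ord (addn2 t) i) ^+ e j.+1.
  move=> kj; rewrite !mxE; congr (_ ^+ e _.+1).
  by rewrite (_ : cast_ord _ k = s j) ?permK //; apply/val_inj.
have exj (k : 'I_(t + 2)) : exists j, k = s j :> nat.
  by exists (s^-1 (cast_ord (addn2 t) k))%g; rewrite permKV.
have pt0 (e' : nat) : point R (cast_ord (addn2 t) (rshift t 0)) ^+ e' = zvar R ^+ e'.
  by rewrite /point /= addn0 ltnn eqxx.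
have pt1 (e' : nat) : point R (cast_ord (addn2 t) (rshift t 1)) ^+ e' = zvar R ^- e'.
  by rewrite /point /= addn1 ltnNge leqnSn /= gtn_eqF // exprVn.
have ulM : ulsubmx M' = fourier R t.
  apply/matrixP => i k; rewrite [LHS]mxE [LHS]mxE [RHS]mxE.
  have [j kj] := exj (lshift 2 k); rewrite (ME _ _ _ kj) point_root //=.
  by rewrite -sS -kj //=.
have urM : ursubmx M' = colsub f (fourier R t).
  apply/matrixP => i c; rewrite [LHS]mxE [LHS]mxE [RHS]mxE [RHS]mxE.
  case: (c =P 0) => [->|/eqP c0].
    by rewrite (ME _ jA) ?point_root //= ?skA // sA addn0.
  have {c0} -> : c = 1 by apply/val_inj; case: c c0 => -[|[]].
  by rewrite (ME _ jB) ?point_root //= ?skB // sB addn1.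
rewrite -[M']submxK ulM urM det_block_colsub; congr (_ * _).
have drE (N : 'M_(t + 2)) i c : (drsubmx N - colsub f (dlsubmx N)) i c =
    N (rshift t i) (rshift t c) - N (rshift t i) (lshift 2 (f c)).
  by rewrite !mxE.
rewrite det_mx22 !drE /=.
have col0 : @rshift t 2 0 = s jA :> nat by rewrite sA /= addn0.
have col1 : @rshift t 2 1 = s jB :> nat by rewrite sB /= addn1.
rewrite !(ME _ _ _ col0) !(ME _ _ _ col1).
rewrite !(ME _ kA (lshift 2 (Ordinal rA))) // !(ME _ kB (lshift 2 (Ordinal rB))) //.
by rewrite !pt0 !pt1.
Qed.

(* With [n] = z^(n/2) - z^(-n/2) this says that cross is - [p - p'] [q - q'] [d]. *)
Lemma cross_factor (K : fieldType) (z : K) (p p' q q' m : nat) (d : int) :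
    z != 0 -> (p' <= p)%N -> (q' <= q)%N ->
    d = p%:Z + p'%:Z - q%:Z - q'%:Z ->
    (p - p' + (q - q') + `|d| = m.*2)%N ->
  cross z p p' q q' * z ^+ m =
  - ((sgz d)%:~R * ((z ^+ (p - p') - 1) * (z ^+ (q - q') - 1) * (z ^+ `|d| - 1))).
Proof.
(* Exchanging the two pairs negates both [cross] and [d]. *)
move=> z0 pp qq dE dm; wlog d_ge0 : p p' q q' d pp qq dE dm / 0 <= d => [wl|].
  have [/wl|/ltW d_le0] := leP 0 d; first by apply.
  have -> : cross z p p' q q' = - cross z q q' p p' by rewrite /cross; ring.
  rewrite mulNr (wl q q' p p' (- d)) //; try lia.
  by rewrite sgzN abszN; ring.
have -> : (sgz d)%:~R * ((z ^+ (p - p') - 1) * (z ^+ (q - q') - 1) *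
    (z ^+ `|d| - 1)) = (z ^+ (p - p') - 1) * (z ^+ (q - q') - 1) * (z ^+ `|d| - 1).
  have [->|d_neq0] := eqVneq d 0; first by rewrite absz0 subrr !mulr0.
  by rewrite gtr0_sgz ?mul1r // lt_def d_neq0.
(* For d >= 0 the half sum is m = p - q', so every power becomes a monomial in the powers of z with
   exponents q', m, p - p', q - q' and their inverses, and the claim a rational identity in four
   variables. *)
have -> : z ^+ `|d| = z ^+ m * z ^+ m / (z ^+ (p - p') * z ^+ (q - q')).
  rewrite -!exprD; apply/(canRL (mulfK _)); first by rewrite expf_neq0.
  by rewrite -exprD; congr (_ ^+ _); lia.
rewrite /cross; have -> : z ^+ q = z ^+ q' * z ^+ (q - q') by rewrite -exprD subnKC.
have -> : z ^+ p' = z ^+ q' * z ^+ m / z ^+ (p - p').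
  apply/(canRL (mulfK _)); first by rewrite expf_neq0.
  by rewrite -!exprD; congr (_ ^+ _); lia.
have -> : z ^+ p = z ^+ q' * z ^+ m by rewrite -exprD; congr (_ ^+ _); lia.
have := expf_neq0 q' z0; have := expf_neq0 m z0.
have := expf_neq0 (p - p') z0; have := expf_neq0 (q - q') z0.
move: (z ^+ q') (z ^+ m) (z ^+ (p - p')) (z ^+ (q - q')) => Z M U V V0 U0 M0 Z0.
by field; rewrite Z0 M0 U0 V0.
Qed.

(** * Sign of the sorting permutation *)

Lemma sum_ltn (j n : nat) : (\sum_(l < n) (j < l) = n - j.+1)%N.
Proof.
elim: n => [|n IHn]; first by rewrite big_ord0.
by rewrite big_ord_recr /= IHn; case: ltnP; lia.
Qed.

Lemma sum_eq_ord (n : nat) (P : pred 'I_n) (j : 'I_n) :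
  (\sum_(k < n | P k) (k == j) = P j)%N.
Proof.
rewrite big_mkcond (bigD1 j) //= eqxx big1 ?addn0; first by case: (P j).
by move=> k /negbTE ->; case: (P k).
Qed.

Lemma signr_even_add (K : pzRingType) (a b c : nat) :
  (a + b = c.*2)%N -> (-1) ^+ a = (-1) ^+ b :> K.
Proof.
move=> abc; rewrite -signr_odd -[RHS]signr_odd; congr (_ ^+ nat_of_bool _).
by have := congr1 odd abc; rewrite oddD odd_double; do 2!case: odd.
Qed.

(* The permutation s sends a column of S to its residue, and the columns of a1 and
   b1 to the last two places. *)
Lemma sign_sorting (t : nat) (lam : t.+2.-tuple nat) (jA jB : 'I_t.+2) (s : 'S_t.+2) :
    is_partition lam -> a1 lam = beta lam jA.+1 -> b1 lam = beta lam jB.+1 ->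
    column lam (a1 lam) = jA.+1 -> column lam (b1 lam) = jB.+1 -> jA != jB ->
    (0 < t)%N ->
    s jA = t :> nat -> s jB = t.+1 :> nat ->
    (forall j, j != jA -> j != jB -> (s j = beta lam j.+1 %% t :> nat)%N) ->
  (-1) ^+ s = - (-1) ^+ (column lam (a1 lam) + column lam (b1 lam) + inversions (bS lam))%N *
      sgz ((a1 lam)%:Z - (b1 lam)%:Z) :> int.
Proof.
move=> lamP aE bE cA cB nAB t_gt0 sA sB sS.
pose P j := j \notin [:: column lam (a1 lam); column lam (b1 lam)].
pose f j := (beta lam j %% t)%N.
have invE : inversions (bS lam) = (\sum_(l < t.+2) \sum_(k < t.+2 | (k < l)%N)
    [&& P (1 + l), P (1 + k) & f (1 + l) < f (1 + k)])%N.
  exact: inversions_filter.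
have sneq (i j : 'I_t.+2) : i != j -> s i != s j :> nat.
  by rewrite val_eqE (inj_eq perm_inj).
(* The value t + 1 at [jB] is the largest, so every later column forms an inversion with it; the
   value t at [jA] does so with every later column except [jB]. All other inversions are those of
   [bS]. *)
have pairE (l k : 'I_t.+2) : (k < l)%N ->
    ((s l < s k) = [&& P (1 + l), P (1 + k) & f (1 + l) < f (1 + k)] +
       ((k == jB) + (k == jA) * (l != jB)) :> nat)%N.
  move=> kl; rewrite /P /f !inE cA cB !add1n !eqSS !val_eqE.
  have lk : l != k by rewrite -val_eqE gtn_eqF.
  have [kB|nkB] := eqVneq k jB.
    rewrite kB sB [jB == jA]eq_sym (negbTE nAB) ?eqxx ?orbT /= ?andbF.
    have := sneq l k lk; rewrite kB sB.
    by have := ltn_ord (s l); lia.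
  have [kA|nkA] := eqVneq k jA.
    rewrite kA sA ?eqxx /= ?andbF.
    have := sneq l k lk; rewrite kA sA.
    have [->|nlB] := eqVneq l jB; first by rewrite sB; lia.
    have := sneq l jB nlB; rewrite sB.
    by have := ltn_ord (s l); lia.
  rewrite (sS k) //=; have := ltn_pmod (beta lam k.+1) t_gt0.
  have [->|nlB] := eqVneq l jB; first by rewrite sB ?eqxx ?orbT /=; lia.
  have [->|nlA] := eqVneq l jA; first by rewrite sA ?eqxx /=; lia.
  by rewrite (sS l) //= addn0.
have sumE : (\sum_(l < t.+2) \sum_(k < t.+2 | (k < l)%N) (s l < s k) =
    inversions (bS lam) + ((t.+1 - jB) + (t.+1 - jA - (jA < jB))))%N.
  rewrite invE; under eq_bigr => l _.
    under eq_bigr => k kl do rewrite pairE //.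
    rewrite big_split /= big_split /=; over.
  rewrite big_split /= big_split /=; congr (_ + (_ + _))%N.
    by rewrite -subSS -(sum_ltn jB t.+2); apply: eq_bigr => l _; rewrite sum_eq_ord.
  under eq_bigr => l _ do rewrite -big_distrl /= sum_eq_ord.
  have := sum_ltn jA t.+2; rewrite subSS => <-.
  rewrite [in RHS](bigD1 jB) //= addKn (bigD1 jB) //= eqxx muln0 add0n.
  by apply: eq_bigr => l ->; rewrite muln1.
rewrite sign_inversions sumE cA cB.
have := ltn_ord jA; have := ltn_ord jB; rewrite !ltnS => jBt jAt.
(* The two extra counts add up to 2(t + 1) - jA - jB - [jA < jB]. The last term is what the sign of
   a1 - b1 records, since beta numbers decrease along the columns. *)
rewrite aE bE; case: (ltngtP jA jB) => [AB|BA|/val_inj AB];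
  last by rewrite AB eqxx in nAB.
  have lt_ba : (beta lam jB.+1 < beta lam jA.+1)%N by apply: beta_lt.
  rewrite gtr0_sgz ?subr_gt0 ?ltz_nat // mulr1 -[RHS]mulN1r -exprS.
  apply: (@signr_even_add _ _ _ (inversions (bS lam) + t.+2)); lia.
have lt_ab : (beta lam jA.+1 < beta lam jB.+1)%N by apply: beta_lt.
rewrite ltr0_sgz ?subr_lt0 ?ltz_nat // mulrN1 opprK.
apply: (@signr_even_add _ _ _ (inversions (bS lam) + t.+2)); lia.
Qed.

(** * Factorization of the alternant *)

(** The half sum is the exponent of z that turns the product of the [d_i] into the product of the
    z^(d_i) - 1. The witness depends on the sign of [dt3]. *)
Lemma triple_half (t : nat) (lam : t.+2.-tuple nat) :
    (a2 lam < a1 lam)%N -> (b2 lam < b1 lam)%N ->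
  exists m : nat, (d1 lam + d2 lam + d3 lam = m.*2)%N.
Proof.
rewrite /d1 /d2 /d3 /dt3 => aa bb.
by case: (leP 0 ((a1 lam)%:Z + (a2 lam)%:Z - (b1 lam)%:Z - (b2 lam)%:Z)) => d;
  [exists (a1 lam - b2 lam)%N | exists (b1 lam - a2 lam)%N]; lia.
Qed.

(** Exactly t beta numbers remain, and they still meet all t residues: the classes of a1 and b1 keep
    the survivors [uA] and [uB]. *)
Lemma uniq_residues (t : nat) (lam : t.+2.-tuple nat) :
  (0 < t)%N -> is_partition lam -> no_empty_class lam ->
  uniq [seq (b %% t)%N | b <- betas lam & b \notin [:: a1 lam; b1 lam]].
Proof.
move=> t_gt0 lamP ne.
have [aL bL nab _ [uA [uB [uAL uBL uAr uBr _]]]] := pairsABP t_gt0 lamP ne.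
apply: (leq_size_uniq (iota_uniq 0 t)) => [r|]; last first.
  rewrite size_map size_iota size_filter -(leq_add2l 2%N).
  have c2 : count (mem [:: a1 lam; b1 lam]) (betas lam) = 2%N.
    rewrite -size_filter; apply: (@perm_size _ _ [:: a1 lam; b1 lam]).
    apply: uniq_perm; first exact: filter_uniq (uniq_betas lamP).
      by rewrite /= inE nab.
    move=> x; rewrite mem_filter /= !inE.
    by apply: andb_idr => /orP[] /eqP->.
  by rewrite -{1}c2 count_predC size_betas.
rewrite mem_iota add0n => /andP[_ rt].
have : residue_class lam r != [::] by rewrite (allP ne) // mem_iota.
case E : (residue_class lam r) => [//|x s] _.
have : x \in residue_class lam r by rewrite E inE eqxx.
rewrite mem_filter => /andP[/eqP <- xL].
have [->|nxa] := eqVneq x (a1 lam); first by rewrite -uAr (map_f (modn^~ t)).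
have [->|nxb] := eqVneq x (b1 lam); first by rewrite -uBr (map_f (modn^~ t)).
by rewrite (map_f (modn^~ t)) // mem_filter !inE negb_or nxa nxb.
Qed.

Lemma uniq_map_inj (T1 T2 : eqType) (f : T1 -> T2) (s : seq T1) :
  uniq (map f s) -> {in s &, injective f}.
Proof.
elim: s => [_ x y //|z s IHs /= /andP[zs us] x y].
rewrite !inE => /predU1P[->|xs] /predU1P[->|ys] // fxy.
- by rewrite fxy map_f in zs.
- by rewrite -fxy map_f in zs.
- exact: IHs fxy.
Qed.

(** The sign is the one that also occurs in [epsilon], so that the two cancel in the product. *)
Definition alternant_const (R : realType) (t : nat) : {fraction {poly R[i]}} :=
  (-1) ^+ (t + 'C(t.+3, 2))%N * \det (fourier R t).

(** This combines [alternant_split], [sign_sorting] and [cross_factor]; the minus signs of the last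
    two cancel. *)
Lemma alternant_factor (R : realType) (t : nat) (lam : t.+2.-tuple nat) :
    (1 < t)%N -> is_partition lam -> no_empty_class lam ->
  exists m : nat, (sumn (triple lam) = m.*2)%N /\
  alternant (beta lam) (@point R t) * zvar R ^+ m =
  alternant_const R t * (epsilon lam)%:~R *
  \prod_(d <- triple lam) (zvar R ^+ d - 1).
Proof.
move=> t_gt1 lamP ne; have t_gt0 := ltnW t_gt1.
have [aL bL nab [a21 b21] [uA [uB [uAL uBL uAr uBr uAB]]]] := pairsABP t_gt0 lamP ne.
have [m mE] := triple_half a21 b21.
exists m; split; first by rewrite -mE /triple /= addn0 addnA.
have column_ord b : b \in betas lam ->
    exists j : 'I_t.+2, column lam b = j.+1 /\ b = beta lam j.+1.
  move=> bl; exists (Ordinal (column_le bl)); split => //.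
  by rewrite /= (_ : (index b (betas lam)).+1 = column lam b) ?beta_column.
have beta_mem (j : 'I_t.+2) : beta lam j.+1 \in betas lam.
  by rewrite map_f // mem_iota /= add1n ltnS.
have beta_inj (i j : 'I_t.+2) : beta lam i.+1 = beta lam j.+1 -> i = j.
  move=> ij; apply/val_inj; case: (ltngtP i j) => // c.
    by have := @beta_lt _ lam i.+1 j.+1 lamP (ltn0Sn i) c (ltn_ord j); rewrite ij ltnn.
  by have := @beta_lt _ lam j.+1 i.+1 lamP (ltn0Sn j) c (ltn_ord i); rewrite ij ltnn.
have [jA [cA aE]] := column_ord _ aL.
have [jB [cB bE]] := column_ord _ bL.
have nAB : jA != jB by apply: contraNneq nab => jAB; rewrite aE bE jAB.
pose rest := [seq b <- betas lam | b \notin [:: a1 lam; b1 lam]].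
have rest_beta (j : 'I_t.+2) : (beta lam j.+1 \in rest) = (j != jA) && (j != jB).
  rewrite mem_filter beta_mem andbT !inE negb_or aE bE.
  by congr (~~ _ && ~~ _); apply/eqP/eqP => [/beta_inj|->].
have rest_ord b : b \in rest ->
    exists j : 'I_t.+2, [/\ b = beta lam j.+1, j != jA & j != jB].
  move=> br; have : b \in betas lam by move: br; rewrite mem_filter => /andP[].
  by case/column_ord => j [_ E]; exists j; move: br; rewrite E rest_beta => /andP[].
have [kA [kAE kAA kAB]] := rest_ord _ uAL.
have [kB [kBE kBA kBB]] := rest_ord _ uBL.
(* The target place of each column: its residue for a column of S, and the last two places for those
   of a1 and b1. Injectivity on S is [uniq_residues]. *)
pose key (j : 'I_t.+2) : nat :=
  if j == jB then t.+1 else if j == jA then t else (beta lam j.+1 %% t)%N.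
have key_lt j : (key j < t.+2)%N.
  rewrite /key; do 2!case: ifP => // _.
  by rewrite (leq_trans (ltn_pmod _ t_gt0)) // ltnW.
have key_inj : injective (fun j => Ordinal (key_lt j)).
  move=> i j /(congr1 val) /=; rewrite /key.
  have modN k : (k %% t)%N != t /\ (k %% t)%N != t.+1.
    by have kt := ltn_pmod k t_gt0; rewrite !ltn_eqF // ltnW.
  have [->|iB] := eqVneq i jB; have [->|jB'] := eqVneq j jB => //.
  - by case: ifP => _; move/eqP; rewrite eq_sym ?(negbTE (modN _).2) // ltn_eqF.
  - by case: ifP => _; move/eqP; rewrite ?(negbTE (modN _).2) // ltn_eqF.
  have [->|iA] := eqVneq i jA; have [->|jA'] := eqVneq j jA => //.
  - by move/esym/eqP; rewrite (negbTE (modN _).1).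
  - by move/eqP; rewrite (negbTE (modN _).1).
  move=> ij; apply: beta_inj.
  by apply: (uniq_map_inj (uniq_residues t_gt0 lamP ne)) ij;
    rewrite rest_beta ?iB ?iA ?jA' ?jB'.
pose s := perm key_inj.
have sA : s jA = t :> nat by rewrite permE /= /key (negbTE nAB) eqxx.
have sB : s jB = t.+1 :> nat by rewrite permE /= /key eqxx.
have sS j : j != jA -> j != jB -> (s j = beta lam j.+1 %% t :> nat)%N.
  by move=> /negbTE jA' /negbTE jB'; rewrite permE /= /key jA' jB'.
have sS' j : (s j < t)%N -> (s j = beta lam j.+1 %% t :> nat)%N.
  move=> sj; apply: sS; apply: contraTneq sj => ->.
    by rewrite sA ltnn.
  by rewrite sB ltnNge leqnSn.
have skA : (s kA = beta lam jA.+1 %% t :> nat)%N by rewrite sS // -kAE uAr aE.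
have skB : (s kB = beta lam jB.+1 %% t :> nat)%N by rewrite sS // -kBE uBr bE.
rewrite (alternant_split R t_gt1 sA sB sS' skA skB) -aE -bE -kAE -kBE.
(* For a class p > q > r the column of r was subtracted from both others, whereas the triple uses
   the pairs p, q and q, r; the two determinants differ by a column operation. *)
have -> : cross (zvar R) (a1 lam) uA (b1 lam) uB =
    cross (zvar R) (a1 lam) (a2 lam) (b1 lam) (b2 lam).
  case: uAB => [[-> ->] //|[-> [-> ->]]].
  by move: (zvar R) => z; rewrite /cross; clear; ring.
have z0 : zvar R != 0 by rewrite tofrac_eq0 polyX_eq0.
have mE' : (a1 lam - a2 lam + (b1 lam - b2 lam) + `|dt3 lam| = m.*2)%N := mE.
have crossE := cross_factor z0 (ltnW a21) (ltnW b21) (erefl (dt3 lam)) mE'.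
rewrite -[LHS]mulrA crossE.
have := sign_sorting lamP aE bE cA cB nAB t_gt0 sA sB sS.
move/(congr1 (fun x : int => x%:~R : {fraction {poly R[i]}})).
rewrite rmorphXn rmorphN rmorph1 => ->.
rewrite /alternant_const /epsilon /triple !big_cons big_nil mulr1.
rewrite !rmorphM !rmorphN !rmorphXn !rmorphN !rmorph1 /d1 /d2 /d3 /=.
set g := (-1) ^+ (t + _)%N.
have sq : g * g = 1 by rewrite -expr2 sqrr_sign.
move: g sq => g; move: (sgz _)%:~R (sgz _)%:~R (\det _) => /= x y D sq.
move: (_ ^+ (_ + _)) => u.
move: (_ - 1) (_ - 1) (_ - 1) => p q r.
transitivity (g * g * (u * x * D * (y * (p * q * r)))); first by rewrite sq; ring.
by ring.
Qed.

(** * Nonvanishing, and comparison of two factorizations *)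

Lemma no_empty_class_alternant (R : realType) (t : nat) (lam : t.+2.-tuple nat) :
    (1 < t)%N -> alternant (beta lam) (@point R t) != 0 -> no_empty_class lam.
Proof. by move=> t_gt1; apply: contraNT => /(alternant_empty_class R t_gt1)->. Qed.

(** With no empty class, [dt3 = 0] makes [epsilon] zero, and the alternant vanishes by its
    factorization. *)
Lemma alternant_triple_defined (R : realType) (t : nat) (lam : t.+2.-tuple nat) :
    (1 < t)%N -> is_partition lam ->
  alternant (beta lam) (@point R t) != 0 -> triple_defined lam.
Proof.
move=> t_gt1 lamP alt_neq0; have ne := no_empty_class_alternant t_gt1 alt_neq0.
rewrite /triple_defined ne; apply: contraNneq alt_neq0 => dt0.
have [m [_]] := alternant_factor R t_gt1 lamP ne.
rewrite /epsilon dt0 sgz0 mulr0 mulr0 mul0r => /eqP.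
by rewrite mulf_eq0 expf_eq0 tofrac_eq0 polyX_eq0 andbF orbF.
Qed.

Lemma triple_gt0 (t : nat) (lam : t.+2.-tuple nat) :
  (0 < t)%N -> is_partition lam -> triple_defined lam -> all (ltn 0) (triple lam).
Proof.
move=> t_gt0 lamP /andP[ne dt0].
have [_ _ _ [a21 b21] _] := pairsABP t_gt0 lamP ne.
by rewrite /= /d1 /d2 /d3 !subn_gt0 a21 b21 absz_gt0 dt0.
Qed.

Lemma epsilon_neq0 (t : nat) (lam : t.+2.-tuple nat) :
  (0 < t)%N -> is_partition lam -> triple_defined lam -> epsilon lam != 0.
Proof.
move=> t_gt0 lamP /andP[ne dt0]; have [_ _ ab _ _] := pairsABP t_gt0 lamP ne.
by rewrite /epsilon !mulf_neq0 ?signr_eq0 ?sgz_eq0 // subr_eq0.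
Qed.

(** After division by the smaller power of X, evaluation at 0 forces [m1 = m2]; as the lists have
    equal length, it also gives [e1 = e2]. The remaining products are compared by
    [perm_eq_prod_Xn_sub1]. *)
Lemma perm_eq_signed_prod (R : realType) (e1 e2 : int) (s1 s2 : seq nat) (m1 m2 : nat) :
    e1 != 0 -> e2 != 0 -> all (ltn 0) s1 -> all (ltn 0) s2 -> size s1 = size s2 ->
  e1%:~R * \prod_(d <- s1) ('X^d - 1) * 'X^m2 =
  e2%:~R * \prod_(d <- s2) ('X^d - 1) * 'X^m1 :> {poly R[i]} ->
  e1 = e2 /\ perm_eq s1 s2.
Proof.
wlog m12 : e1 e2 s1 s2 m1 m2 / (m1 <= m2)%N =>
    [wl|] e1_neq0 e2_neq0 s1_gt0 s2_gt0 sz eq12.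
  have [c|/ltnW c] := leqP m1 m2; first exact: wl eq12.
  have [-> p] := wl _ _ _ _ _ _ c e2_neq0 e1_neq0 s2_gt0 s1_gt0 (esym sz) (esym eq12).
  by rewrite perm_sym.
have prod0 (s : seq nat) : all (ltn 0) s ->
    (\prod_(d <- s) ('X^d - 1) : {poly R[i]}).[0] = (-1) ^+ size s.
  elim: s => [|d s IHs]; first by rewrite big_nil hornerC.
  rewrite big_cons hornerM /= => /andP[d_gt0 /IHs ->].
  by rewrite !hornerE expr0n gtn_eqF // sub0r exprS.
have intr0 (e : int) : (e%:~R : {poly R[i]}) = (e%:~R)%:P by rewrite rmorph_int.
have {}eq12 : e1%:~R * \prod_(d <- s1) ('X^d - 1) * 'X^(m2 - m1) =
    e2%:~R * \prod_(d <- s2) ('X^d - 1) :> {poly R[i]}.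
  apply: (mulIf (x := 'X^m1)); first by rewrite expf_neq0 ?polyX_eq0.
  by rewrite -[LHS]mulrA -exprD subnK.
have := congr1 (fun p : {poly R[i]} => p.[0]) eq12.
rewrite !hornerM !intr0 !hornerC !prod0 // -sz hornerXn expr0n.
case: eqP => [m0|_]; last first.
  by rewrite mulr0 => /esym/eqP; rewrite mulf_eq0 signr_eq0 intr_eq0 (negbTE e2_neq0).
have sg0 : (-1) ^+ size s1 != 0 :> R[i] by rewrite signr_eq0.
rewrite mulr1 => /(mulIf sg0) /intr_inj e12; split => //.
move: eq12; rewrite m0 mulr1 e12; move/mulfI => eq12.
apply: perm_eq_prod_Xn_sub1 (eq12 _) => //.
by rewrite intr0 polyC_eq0 intr_eq0.
Qed.

Lemma alternant_const_neq0 (R : realType) (t : nat) :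
  (1 < t)%N -> alternant_const R t != 0.
Proof.
by move=> t_gt1; apply: mulf_neq0; rewrite ?signr_eq0 ?det_fourier_neq0.
Qed.

Unset Implicit Arguments.

Theorem proposition3p10 (R : realType) (t : nat) (ht : (2 <= t)%N)
    (lam mu : t.+2.-tuple nat)
    (hlam : is_partition lam) (hmu : is_partition mu)
    (hPhi : Phi R lam != 0) :
  Phi R lam = Phi R mu <->
  [/\ triple_defined mu,
      perm_eq (triple lam) (triple mu) &
      epsilon lam = epsilon mu].
Proof.
have t_gt0 := ltnW ht.
have den_neq0 := point_alternant_neq0 R ht.
have PhiE (nu : t.+2.-tuple nat) : Phi R nu = alternant (beta nu) (@point R t) /
    alternant (fun j => t.+2 - j)%N (@point R t) by [].
have alt_neq0 (nu : t.+2.-tuple nat) :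
    Phi R nu != 0 -> alternant (beta nu) (@point R t) != 0.
  by rewrite PhiE mulf_eq0 negb_or => /andP[].
have C_neq0 := alternant_const_neq0 R ht.
have z_neq0 : zvar R != 0 by rewrite tofrac_eq0 polyX_eq0.
have lam_def := alternant_triple_defined ht hlam (alt_neq0 _ hPhi).
have [m [sum_m lamE]] := alternant_factor R ht hlam (proj1 (andP lam_def)).
split=> [eqPhi|[mu_def eq_triple eq_eps]]; last first.
  have [m' [sum_m' muE]] := alternant_factor R ht hmu (proj1 (andP mu_def)).
  (* Equal triples have equal half sums, so the same power of z is cancelled for both partitions. *)
  have mm' : m = m' by apply: double_inj; rewrite -sum_m -sum_m' (perm_sumn eq_triple).
  rewrite !PhiE; congr (_ / _); apply: (mulIf (expf_neq0 m z_neq0)).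
  by rewrite lamE mm' muE eq_eps (perm_big _ eq_triple).
have mu_def : triple_defined mu.
  by apply: (alternant_triple_defined ht hmu (alt_neq0 _ _)); rewrite -eqPhi.
have [m' [_ muE]] := alternant_factor R ht hmu (proj1 (andP mu_def)).
have eq_alt : alternant (beta lam) (@point R t) = alternant (beta mu) (@point R t).
  by move: eqPhi; rewrite !PhiE; apply: mulIf; rewrite invr_eq0.
have prodE (s : seq nat) : \prod_(d <- s) (zvar R ^+ d - 1) =
    tofrac (\prod_(d <- s) ('X^d - 1)).
  by rewrite rmorph_prod; apply: eq_bigr => d _; rewrite rmorphB rmorphXn rmorph1.
have [eq_eps eq_triple] : epsilon lam = epsilon mu /\ perm_eq (triple lam) (triple mu).
  (* Multiplying each factorization by the power of z belonging to the other makes the left sides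
     equal; injectivity of [tofrac] brings the identity down to polynomials. *)
  apply: (@perm_eq_signed_prod R _ _ _ _ m m'); rewrite ?epsilon_neq0 ?triple_gt0 //.
  apply/eqP; rewrite -tofrac_eq !tofracM !tofracXn -!prodE !rmorph_int; apply/eqP.
  apply: (mulfI C_neq0); rewrite !mulrA -lamE -muE eq_alt.
  by rewrite mulrAC.
by split.
Qed.
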